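(* Let $\Gamma\subseteq\mathfrak{S}$ be a set of permutations, each of length at least $2$. Define, in the algebra $\mathbb{Q}\langle\langle A^{*}\rangle\rangle[[s]]$ (where $s$ commutes with all $X_i$), \[ \bar{F}_{\Gamma}(s)\coloneqq\sum_{\pi\in\mathfrak{S}}\mathbf{G}_{\pi}s^{\operatorname{occ}_{\Gamma}(\pi)}\quad\text{and}\quad\bar{R}_{\Gamma}(s)\coloneqq\sum_{\pi\in\mathfrak{S}}\mathbf{G}_{\pi}\sum_{c\in C_{\Gamma,\pi}}s^{\operatorname{mk}_{\Gamma}(c)}. \] Then \[ \bar{F}_{\Gamma}(s)=\Big(1-\mathbf{G}_{1}-\bar{R}_{\Gamma}(s-1)\Big)^{-1}. \]
   Context: $\mathfrak{S}_n$ is the set of permutations of $[n]=\{1,\dots,n\}$ in one-line notation $\pi=\pi_1\pi_2\cdots\pi_n$ ($\mathfrak{S}_0$ contains only the empty permutation) and $\mathfrak{S}=\bigsqcup_{n\ge0}\mathfrak{S}_n$; the length of $\pi\in\mathfrak{S}_n$ is $n$. For a word $w=w_1\cdots w_n$ of positive integers, $\operatorname{std}(w)$ is the permutation in $\mathfrak{S}_n$ obtained by replacing the letters of $w$ by $1,\dots,n$ in order of size, where equal letters are regarded as increasing from left to right (so $\operatorname{std}(145411)=146523$). For $\pi\in\mathfrak{S}_n$ and $\sigma\in\mathfrak{S}_m$, an occurrence of $\sigma$ in $\pi$ is an index $i\in[n-m+1]$ with $\operatorname{std}(\pi_i\pi_{i+1}\cdots\pi_{i+m-1})=\sigma$. For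 $\Gamma\subseteq\mathfrak{S}$, $\operatorname{occ}_\Gamma(\pi)$ is the number of pairs $(i,\sigma)$ with $\sigma\in\Gamma$ and $i$ an occurrence of $\sigma$ in $\pi$ (such a pair is a marked occurrence). A $\Gamma$-cluster on $\pi\in\mathfrak{S}_n$ is a nonempty set $c$ of marked occurrences in $\pi$ of patterns in $\Gamma$ such that for every $j\in[n-1]$ some $(i,\sigma)\in c$ with $\sigma\in\mathfrak{S}_m$ satisfies $i\le j<i+m-1$ (equivalently, the marked permutation is not a concatenation of two nonempty marked permutations). $C_{\Gamma,\pi}$ is the set of $\Gamma$-clusters on $\pi$ and $\operatorname{mk}_\Gamma(c)=|c|$. Let $A=\{X_1,X_2,\dots\}$ be noncommuting variables and $\mathbb{Q}\langle\langle A^*\rangle\rangle$ the algebra of formal (possibly infinite) $\mathbb{Q}$-linear combinations of words in $A$. For a monomial $\mathbf{X}=X_{i_1}\cdots X_{i_n}$ set $\operatorname{std}(\mathbf{X})=\operatorname{std}(i_1\cdots i_n)$, and for $\pi\in\mathfrak{S}$ let $\mathbf{G}_\pi=\sum_{\operatorname{std}(\mathbf{X})=\pi}\mathbf{X}$. In particular $\mathbf{G}_1=X_1+X_2+\cdots$. The inverse is taken in $\mathbb{Q}\langle\langle A^{*}\rangle\rangle[[s]]$. *)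

(* Defs.v *)
From HB Require Import structures.
From mathcomp Require Import all_boot all_order all_algebra all_fingroup.
From mathcomp Require Import boolp classical_sets functions cardinality fsbigop.

Set Implicit Arguments.
Unset Strict Implicit.
Unset Printing Implicit Defensive.
Import Order.TTheory GRing.Theory Num.Theory.

Local Open Scope ring_scope.

Lemma sum_triangle (V : nmodType) (F : nat -> nat -> V) n :
  \sum_(i < n.+1) \sum_(j < i.+1) F i j =
  \sum_(j < n.+1) \sum_(l < (n - j).+1) F (j + l)%N j.
Proof.
elim: n => [|n IHn]; first by rewrite !big_ord1.
rewrite big_ord_recr /= IHn [RHS]big_ord_recr /= subnn big_ord1 addn0.
rewrite [X in _ + X]big_ord_recr /= addrA; congr (_ + _).
rewrite -big_split /=; apply: eq_bigr => j _.
rewrite subSn -1?ltnS // [RHS]big_ord_recr /=; congr (_ + F _ _).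
by rewrite -subSn -1?ltnS // subnKC // ltnW.
Qed.

(* [ncseries R] is R<<A^*>> for A = {X_1, X_2, ...}. A word in A is a          *)
(* [seq nat], the letter [i : nat] standing for X_(i+1); a series is the       *)
(* family of its coefficients.                                                 *)
Definition ncseries (R : Type) : Type := seq nat -> R.

Section NCSeriesRing.
Variable R : nzRingType.
Implicit Types f g h : ncseries R.

HB.instance Definition _ :=
  GRing.Zmodule.copy (ncseries R) (seq nat -> R).

Definition ncs_one : ncseries R := fun w => (w == [::])%:R.

Definition ncs_mul f g : ncseries R :=
  fun w => \sum_(i < (size w).+1) f (take i w) * g (drop i w).

Lemma ncs_mulA : associative ncs_mul.
Proof.
move=> f g h; apply/funext => w; rewrite /ncs_mul; symmetry.
pose F i j := f (take j w) * g (drop j (take i w)) * h (drop i w).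
transitivity (\sum_(i < (size w).+1) \sum_(j < i.+1) F i j).
  apply: eq_bigr => i _; rewrite size_takel -1?ltnS // big_distrl /=.
  by apply: eq_bigr => j _; rewrite /F take_takel // -ltnS.
rewrite sum_triangle; apply: eq_bigr => j _.
rewrite size_drop big_distrr /=; apply: eq_bigr => l _.
by rewrite /F take_drop drop_drop mulrA [(l + j)%N]addnC.
Qed.

Lemma ncs_mul1 : left_id ncs_one ncs_mul.
Proof.
move=> f; apply/funext => w; rewrite /ncs_mul /ncs_one big_ord_recl /=.
rewrite take0 drop0 mul1r big1 ?addr0 // => i _; case: w i => [|x w] [i lti] //=.
by rewrite mul0r.
Qed.

Lemma ncs_mulr1 : right_id ncs_one ncs_mul.
Proof.
move=> f; apply/funext => w; rewrite /ncs_mul /ncs_one big_ord_recr /=.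
rewrite take_size drop_size mulr1 big1 ?add0r // => i _.
by rewrite -size_eq0 size_drop subn_eq0 leqNgt ltn_ord mulr0.
Qed.

Lemma ncs_mulDl : left_distributive ncs_mul +%R.
Proof.
move=> f g h; apply/funext => w; rewrite /ncs_mul.
rewrite [RHS]/GRing.add /= -big_split /=.
by apply: eq_bigr => i _; rewrite -mulrDl.
Qed.

Lemma ncs_mulDr : right_distributive ncs_mul +%R.
Proof.
move=> f g h; apply/funext => w; rewrite /ncs_mul.
rewrite [RHS]/GRing.add /= -big_split /=.
by apply: eq_bigr => i _; rewrite -mulrDr.
Qed.

Lemma ncs_one_neq0 : ncs_one != 0.
Proof.
by apply/eqP => /(congr1 (@^~ [::])) /eqP; rewrite /ncs_one eqxx oner_eq0.
Qed.

HB.instance Definition _ := GRing.Zmodule_isNzRing.Build (ncseries R)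
  ncs_mulA ncs_mul1 ncs_mulr1 ncs_mulDl ncs_mulDr ncs_one_neq0.

Lemma ncs_mulE f g w :
  (f * g) w = \sum_(i < (size w).+1) f (take i w) * g (drop i w).
Proof. by []. Qed.

Lemma ncs_oneE w : (1 : ncseries R) w = (w == [::])%:R.
Proof. by []. Qed.

End NCSeriesRing.

(* [powerseries R] is R[[s]], where s commutes with R; a series is the         *)
(* sequence of its coefficients.                                               *)
Definition powerseries (R : Type) : Type := nat -> R.

Section PowerSeriesRing.
Variable R : nzRingType.
Implicit Types f g h : powerseries R.

HB.instance Definition _ :=
  GRing.Zmodule.copy (powerseries R) (nat -> R).

Definition ps_const (a : R) : powerseries R :=
  fun k => if k == 0%N then a else 0.

Definition ps_var : powerseries R := fun k => (k == 1%N)%:R.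

Definition ps_mul f g : powerseries R :=
  fun k => \sum_(i < k.+1) f i * g (k - i)%N.

Lemma ps_mulA : associative ps_mul.
Proof.
move=> f g h; apply/funext => k; rewrite /ps_mul; symmetry.
pose F i j := f j * g (i - j)%N * h (k - i)%N.
transitivity (\sum_(i < k.+1) \sum_(j < i.+1) F i j).
  by apply: eq_bigr => i _; rewrite big_distrl.
rewrite sum_triangle; apply: eq_bigr => j _.
rewrite big_distrr /=; apply: eq_bigr => l _.
by rewrite /F addKn subnDA mulrA.
Qed.

Lemma ps_mul1 : left_id (ps_const 1) ps_mul.
Proof.
move=> f; apply/funext => k; rewrite /ps_mul /ps_const big_ord_recl /=.
by rewrite subn0 mul1r big1 ?addr0 // => i _; rewrite mul0r.
Qed.

Lemma ps_mulr1 : right_id (ps_const 1) ps_mul.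
Proof.
move=> f; apply/funext => k; rewrite /ps_mul /ps_const big_ord_recr /=.
rewrite subnn mulr1 big1 ?add0r // => i _.
by rewrite subn_eq0 leqNgt ltn_ord mulr0.
Qed.

Lemma ps_mulDl : left_distributive ps_mul +%R.
Proof.
move=> f g h; apply/funext => k; rewrite /ps_mul.
rewrite [RHS]/GRing.add /= -big_split /=.
by apply: eq_bigr => i _; rewrite -mulrDl.
Qed.

Lemma ps_mulDr : right_distributive ps_mul +%R.
Proof.
move=> f g h; apply/funext => k; rewrite /ps_mul.
rewrite [RHS]/GRing.add /= -big_split /=.
by apply: eq_bigr => i _; rewrite -mulrDr.
Qed.

Lemma ps_one_neq0 : ps_const 1 != 0.
Proof.
by apply/eqP => /(congr1 (@^~ 0%N)) /eqP; rewrite /ps_const oner_eq0.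
Qed.

HB.instance Definition _ := GRing.Zmodule_isNzRing.Build (powerseries R)
  ps_mulA ps_mul1 ps_mulr1 ps_mulDl ps_mulDr ps_one_neq0.

Lemma ps_mulE f g k : (f * g) k = \sum_(i < k.+1) f i * g (k - i)%N.
Proof. by []. Qed.

Lemma ps_oneE : 1 = ps_const 1.
Proof. by []. Qed.

(* Invertible means having a two-sided inverse. *)
Definition ps_unit : pred (powerseries R) :=
  fun f => `[< exists g, g * f = 1 /\ f * g = 1 >].

Definition ps_inv f : powerseries R :=
  if pselect (exists g, g * f = 1 /\ f * g = 1) is left ex
  then sval (cid ex) else f.

Lemma ps_mulVr : {in ps_unit, left_inverse 1 ps_inv *%R}.
Proof.
move=> f /asboolP exg; rewrite /ps_inv; case: pselect => // ex.
by case: (cid ex) => g [].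
Qed.

Lemma ps_divrr : {in ps_unit, right_inverse 1 ps_inv *%R}.
Proof.
move=> f /asboolP exg; rewrite /ps_inv; case: pselect => // ex.
by case: (cid ex) => g [].
Qed.

Lemma ps_unitrP f g : g * f = 1 /\ f * g = 1 -> ps_unit f.
Proof. by move=> fg; apply/asboolP; exists g. Qed.

Lemma ps_invr_out : {in [predC ps_unit], ps_inv =1 id}.
Proof. by move=> f /asboolP nexg; rewrite /ps_inv; case: pselect. Qed.

HB.instance Definition _ := GRing.NzRing_hasMulInverse.Build (powerseries R)
  ps_mulVr ps_divrr ps_unitrP ps_invr_out.

End PowerSeriesRing.

(* Q<<A^*>>[[s]] *)
Notation QAs := (powerseries (ncseries rat)).

(* Sum of a formally summable family: the coefficient of each w s^k is the     *)
(* sum of the (finitely many nonzero) coefficients of w s^k in the F i.        *)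
Definition formal_sum (I : choiceType) (F : I -> QAs) : QAs :=
  fun k w => \sum_(i \in [set: I]) F i k w.

Definition perms : Type := {n : nat & 'S_n}.

HB.instance Definition _ := Choice.on perms.

Definition plen (p : perms) : nat := tag p.

Definition one_line (p : perms) : seq nat :=
  [seq (nat_of_ord (tagged p i)).+1 | i <- enum 'I_(tag p)].

Section Standardization.
Variable w : seq nat.

(* The order in which the positions of w are numbered. *)
Definition std_lt (i j : 'I_(size w)) : bool :=
  (nth 0 w i < nth 0 w j)%N || (nth 0 w i == nth 0 w j) && (i < j)%N.

Lemma std_lt_irr i : std_lt i i = false.
Proof. by rewrite /std_lt !ltnn andbF. Qed.

Lemma std_lt_trans : transitive std_lt.
Proof.
move=> j i k; rewrite /std_lt.
case: (ltngtP (nth 0 w i) (nth 0 w j)) => //= [lt_ij|->].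
  by move=> _ /orP[/(ltn_trans lt_ij)->|/andP[/eqP<- _]] //; rewrite lt_ij.
move=> lt_ij /orP[->//|/andP[-> /(ltn_trans lt_ij)->]]; exact: orbT.
Qed.

Lemma std_lt_total i j : i != j -> std_lt i j || std_lt j i.
Proof.
rewrite /std_lt -val_eqE /=.
by case: (ltngtP (nth 0 w i)) => //= _; case: (ltngtP i j).
Qed.

Lemma std_rank_subproof (i : 'I_(size w)) :
  (#|[set j | std_lt j i]| < size w)%N.
Proof.
rewrite -[X in (_ < X)%N]card_ord -cardsT; apply: proper_card.
by rewrite properE finset.subsetT; apply/subsetPn; exists i; rewrite !inE ?std_lt_irr.
Qed.

Definition std_rank (i : 'I_(size w)) : 'I_(size w) :=
  Ordinal (std_rank_subproof i).

Lemma std_rank_mono i j : std_lt i j -> (std_rank i < std_rank j)%N.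
Proof.
move=> lt_ij /=; apply: proper_card; apply/properP; split.
  by apply/fintype.subsetP => k; rewrite !inE => /std_lt_trans; apply.
by exists i; rewrite !inE ?std_lt_irr.
Qed.

Lemma std_rank_inj : injective std_rank.
Proof.
move=> i j eq_r; apply/eqP; apply: contraT => /std_lt_total.
by case/orP=> /std_rank_mono; rewrite eq_r ltnn.
Qed.

Definition std : perms := existT (fun n => 'S_n) (size w) (perm std_rank_inj).

End Standardization.

(* The one-line notation of the pattern sigma begins at (0-based) position i:  *)
(* this is index i+1 of the usual 1-based numbering.                           *)
Definition occurs_at (sigma pi : perms) (i : nat) : bool :=
  (i + plen sigma <= plen pi)%N &&
  (std (take (plen sigma) (drop i (one_line pi))) == sigma).

(* Pairs (i, sigma) with i <= n and sigma of length at most n: no other pair   *)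
(* can be a marked occurrence in a permutation of length n.                    *)
Definition marks (n : nat) : finType := ('I_n.+1 * {m : 'I_n.+1 & 'S_m})%type.

Definition mark_pos n (x : marks n) : nat := x.1.

Definition mark_pat n (x : marks n) : perms :=
  existT (fun m => 'S_m) (tag x.2 : nat) (tagged x.2).

Section Clusters.
Variable Gamma : set perms.

Definition marked_occurrences (pi : perms) : {set marks (plen pi)} :=
  [set x | (mark_pat x \in Gamma) &&
           occurs_at (mark_pat x) pi (mark_pos x)].

Definition occ (pi : perms) : nat := #|marked_occurrences pi|.

(* With i and j both 0-based, j ranges over 0, ..., n - 2 and the condition    *)
(* i <= j < i + m - 1 keeps its form.                                          *)
Definition is_cluster (pi : perms) (c : {set marks (plen pi)}) : bool :=
  [&& c != finset.set0, c \subset marked_occurrences pi &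
      [forall j : 'I_(plen pi).-1, exists x in c,
        (mark_pos x <= j)%N && (j.+1 < mark_pos x + plen (mark_pat x))%N]].

Definition clusters (pi : perms) : {set {set marks (plen pi)}} :=
  [set c | is_cluster c].

Definition mk (pi : perms) (c : {set marks (plen pi)}) : nat := #|c|.

End Clusters.

Definition G (pi : perms) : ncseries rat := fun w => (std w == pi)%:R.

(* The families summed in [Fbar] and [Rbar] are formally summable. *)
Lemma G_summable (a : perms -> QAs) k w :
  finite_set [set pi | (ps_const (G pi) * a pi) k w != 0]%classic.
Proof.
apply: (@sub_finite_set _ _
  [set std (take i w) | i in `I_(size w).+1]%classic).
  move=> pi /=; rewrite ps_mulE => nz.
  have [|ne] := pselect (exists2 i, (i < (size w).+1)%N & std (take i w) = pi).
    by case=> i; exists i.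
  case/eqP: nz; rewrite big_ord_recl big1 => [|i _]; last first.
    by rewrite /ps_const /= mul0r.
  rewrite addr0 /ps_const /= ncs_mulE big1 // => i _.
  rewrite /G; case: eqP => [eq_pi|]; last by rewrite mul0r.
  by case: ne; exists i.
exact/finite_image/finite_II.
Qed.

(* [G perm_single] is G_1 = X_1 + X_2 + ... *)
Definition perm_single : perms := existT (fun n => 'S_n) 1%N 1%g.

(* [Fbar Gamma t] and [Rbar Gamma t] are F(t) and R(t), so that R(s - 1) is    *)
(* [Rbar Gamma (ps_var _ - 1)].                                                *)
Definition Fbar (Gamma : set perms) (t : QAs) : QAs :=
  formal_sum (fun pi => ps_const (G pi) * t ^+ occ Gamma pi).

Definition Rbar (Gamma : set perms) (t : QAs) : QAs :=
  formal_sum (fun pi =>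
    ps_const (G pi) * \sum_(c in clusters Gamma pi) t ^+ mk c).

(* Main.v *)
(* Put t = s - 1. At a word w, the series F(s) is s^occ = (1 + t)^occ, that is *)
(* the sum of t^|S| over all sets S of marked occurrences in w. Cut a nonempty *)
(* w at the first positive position that no element of S straddles (possibly   *)
(* its end): the marks to the left of the cut form a cluster, or the left part *)
(* is a single letter without marks, and the marks to the right are arbitrary. *)
(* Hence F = 1 + (G_1 + R(t)) F. A right inverse of 1 - K with K free of       *)
(* constant term is also a left inverse, because y = K y forces y = 0.         *)

From HB Require Import structures.
Require Import Defs.
From mathcomp Require Import all_boot all_order all_algebra all_fingroup.
From mathcomp Require Import boolp classical_sets functions cardinality fsbigop.
From mathcomp Require Import zify.

Set Implicit Arguments.
Unset Strict Implicit.
Unset Printing Implicit Defensive.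
Import GRing.Theory.

Local Open Scope ring_scope.

(** With t = s - 1 we have s^occ = (1 + t)^occ, so the coefficient of F at a word [w] is the sum of
    t^|S| over all sets S of marked occurrences in [w] ([sum_expr_window]). For nonempty [w],
    cutting S at its first break turns this into a sum over the ways to split [w]
    ([sum_subset_first_break]): on the prefix S is a cluster, or is empty on a single letter
    ([sum_expr_linked]), and on the suffix it is arbitrary. As words multiply by concatenation, this
    says F = 1 + K F with K = G_1 + R(t), and [ncs_right_inverse_left] makes F a two-sided inverse
    of 1 - K.

    Two translations support this. Marked occurrences in the standardization of a factor become
    intervals of positions of [w], so that prefix and suffix share one finite type; this rests on
    [std_factor_one_line]. And the coefficient at each word is a polynomial in s, so the computation
    is done over {poly rat} and carried over by the ring morphism [of_pncs]. *)

(** * Noncommutative series with polynomial coefficients *)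

Lemma ncs_subE (R : nzRingType) (f g : ncseries R) w : (f - g) w = f w - g w.
Proof. by []. Qed.

Definition ncs_const (R : nzRingType) (a : R) : ncseries R :=
  fun w => if w == [::] then a else 0.

Lemma ncs_mul_constr (R : nzRingType) (f : ncseries R) (a : R) w :
  (f * ncs_const a) w = f w * a.
Proof.
rewrite ncs_mulE big_ord_recr /= take_size drop_size big1 ?add0r // => i _.
by rewrite /ncs_const -size_eq0 size_drop subn_eq0 leqNgt ltn_ord mulr0.
Qed.

Lemma ncs_const_is_zmod_morphism (R : nzRingType) :
  zmod_morphism (@ncs_const R).
Proof.
move=> a b; apply/funext => w; rewrite ncs_subE /ncs_const.
by case: eqP; rewrite ?subr0.
Qed.

Lemma ncs_const_is_monoid_morphism (R : nzRingType) :
  monoid_morphism (@ncs_const R).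
Proof.
split=> [|a b]; apply/funext => w.
  by rewrite ncs_oneE /ncs_const; case: eqP.
by rewrite ncs_mul_constr /ncs_const; case: eqP; rewrite ?mul0r.
Qed.

HB.instance Definition _ (R : nzRingType) :=
  GRing.isZmodMorphism.Build R (ncseries R) (@ncs_const R)
    (@ncs_const_is_zmod_morphism R).
HB.instance Definition _ (R : nzRingType) :=
  GRing.isMonoidMorphism.Build R (ncseries R) (@ncs_const R)
    (@ncs_const_is_monoid_morphism R).

(* Every series in the theorem has, at each word, finitely many powers of s:   *)
(* the computation takes place in Q[s]<<A^*>>, of which this is the embedding. *)
Definition of_pncs (f : ncseries {poly rat}) : QAs := fun k w => (f w)`_k.

Lemma of_pncs_is_zmod_morphism : zmod_morphism of_pncs.
Proof.
move=> f g; apply/funext => k; apply/funext => w.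
by rewrite /of_pncs ncs_subE coefB.
Qed.

Lemma sum_ncsE (R : nzRingType) (I : Type) (r : seq I) (P : pred I)
    (F : I -> ncseries R) w :
  (\sum_(i <- r | P i) F i) w = \sum_(i <- r | P i) F i w.
Proof.
by rewrite (big_morph (fun f : ncseries R => f w) (id1 := 0) (op1 := +%R)).
Qed.

Lemma of_pncs_is_monoid_morphism : monoid_morphism of_pncs.
Proof.
split=> [|f g]; apply/funext => k.
  apply/funext => w; rewrite /of_pncs ncs_oneE ps_oneE /ps_const.
  by case: k => [|k]; rewrite /= ?ncs_oneE; case: (w == [::]);
    rewrite ?coef1 ?coef0.
rewrite ps_mulE; apply/funext => w; rewrite sum_ncsE /of_pncs ncs_mulE coef_sum.
under eq_bigr do rewrite coefM.
by rewrite exchange_big.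
Qed.

HB.instance Definition _ :=
  GRing.isZmodMorphism.Build (ncseries {poly rat}) QAs of_pncs
    of_pncs_is_zmod_morphism.
HB.instance Definition _ :=
  GRing.isMonoidMorphism.Build (ncseries {poly rat}) QAs of_pncs
    of_pncs_is_monoid_morphism.

Lemma of_pncsX : of_pncs (ncs_const 'X) = ps_var (ncseries rat).
Proof.
apply/funext => k; apply/funext => w; rewrite /of_pncs /ps_var /ncs_const.
transitivity ((w == [::])%:R * (k == 1%N)%:R : rat).
  by case: (w == [::]); rewrite ?coefX ?coef0 ?mul1r ?mul0r.
by case: (k == 1%N); rewrite ?mulr0 ?mulr1.
Qed.

Lemma of_pncsC (g : ncseries rat) : of_pncs (fun w => (g w)%:P) = ps_const g.
Proof.
apply/funext => k; apply/funext => w; rewrite /of_pncs /ps_const coefC.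
by case: eqP.
Qed.

Lemma ps_constM_of_pncs (g : ncseries rat) (p : {poly rat}) k w :
  (ps_const g * of_pncs (ncs_const p)) k w = g w * p`_k.
Proof.
rewrite -of_pncsC -rmorphM -[LHS]/((_ * ncs_const p) w)`_k.
by rewrite ncs_mul_constr coefCM.
Qed.

(** Each word has exactly one standardization, so at [w] only the term pi = [std w] of the formal
    sum survives. *)
Lemma formal_sum_G (p : perms -> {poly rat}) :
  formal_sum (fun pi => ps_const (G pi) * of_pncs (ncs_const (p pi))) =
  of_pncs (fun w => p (std w)).
Proof.
apply/funext => k; apply/funext => w; rewrite /formal_sum.
rewrite -(@fsbig_widen _ _ _ _ [set std w]%classic) //.
  by rewrite fsbig_set1 ps_constM_of_pncs /G eqxx mul1r.
move=> pi /= [_ /eqP ne].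
by rewrite ps_constM_of_pncs /G eq_sym (negPf ne) mul0r.
Qed.

(** The defect y = g (1 - f) - 1 satisfies y = f y. Since f vanishes at the empty word, the
    coefficient of f y at [w] involves y only at proper suffixes of [w], and induction on length
    gives y = 0. *)
Lemma ncs_right_inverse_left (R : nzRingType) (f g : ncseries R) :
  f [::] = 0 -> (1 - f) * g = 1 -> g * (1 - f) = 1.
Proof.
move=> f0 fg; apply/subr0_eq; set y := _ - 1.
have yE : y = f * y.
  apply/subr0_eq; rewrite -{1}[y]mul1r -mulrBl /y mulrBr mulrA fg mul1r mulr1.
  exact: subrr.
apply/funext => w; move: {2}(size w) (leqnn (size w)) => n.
elim: n w => [|n IHn] w le_n; rewrite yE ncs_mulE big_ord_recl take0 f0
  mul0r add0r.
  by rewrite big1 // => -[i lti]; move: lti (le_n); case: (size w).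
rewrite big1 // => i _; rewrite IHn ?mulr0 // size_drop lift0 leq_subLR.
by apply: leq_trans le_n _; rewrite addSnnS leq_addl.
Qed.

(** * Sums over sets of intervals *)

(** Expand a product over all of T in which the factor is t + 1 on A and 0 + 1 off A: subsets not
    contained in A contribute 0. *)
Lemma sum_expr_subset (R : comNzRingType) (T : finType) (A : {set T}) (t : R) :
  \sum_(S : {set T} | S \subset A) t ^+ #|S| = (1 + t) ^+ #|A|.
Proof.
transitivity (\prod_i ((if i \in A then t else 0) + 1)); last first.
  rewrite -prodr_const [RHS]big_mkcond /=; apply: eq_bigr => i _.
  by case: (i \in A); rewrite ?add0r // addrC.
rewrite bigA_distr big_mkcond; apply: eq_bigr => S _; rewrite -big_mkcond /=.
case: ifPn => [/fintype.subsetP sSA | /subsetPn[i Si Ai]].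
  by rewrite (eq_bigr (fun=> t)) ?prodr_const // => i /sSA ->.
by rewrite (bigD1 i) //= (negPf Ai) mul0r.
Qed.

(* A pair x stands for the factor of a word occupying the positions            *)
(* x.1, ..., x.2 - 1.                                                          *)
Definition interval (n : nat) : finType := ('I_n.+1 * 'I_n.+1)%type.

Definition window n (A : {set interval n}) (a b : nat) : {set interval n} :=
  [set x in A | (a <= x.1)%N && (x.2 <= b)%N].

Lemma windowS n (A B : {set interval n}) a b :
  A \subset B -> window A a b \subset window B a b.
Proof.
move=> /fintype.subsetP sAB; apply/fintype.subsetP => x.
by rewrite !inE => /andP[/sAB->].
Qed.

(** Position j is the gap between letters j - 1 and j; the strict inequalities say that both letters
    lie in x. *)
Definition straddles n (x : interval n) (j : nat) : bool := (x.1 < j < x.2)%N.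

Definition linked n (S : {set interval n}) (a b : nat) : bool :=
  [forall j : 'I_n.+1, (a < j < b)%N ==> [exists x in S, straddles x j]].

Definition is_break n (S : {set interval n}) (j : 'I_n.+1) : bool :=
  (0 < j)%N && [forall x in S, ~~ straddles x j].

(** The starting witness [ord_max] is the end of the word, which no interval straddles; it is a
    break as soon as n > 0. *)
Definition first_break n (S : {set interval n}) : 'I_n.+1 :=
  [arg min_(j < ord_max | is_break S j) (j : nat)].

Lemma first_breakP n (S : {set interval n}) (i : 'I_n.+1) : (0 < n)%N ->
  reflect (is_break S i /\ linked S 0 i) (first_break S == i).
Proof.
move=> n_gt0; have brk_max : is_break S ord_max.
  rewrite /is_break n_gt0; apply/fintype.forall_inP => x _.
  by rewrite /straddles negb_and -!leqNgt /= leq_ord orbT.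
rewrite /first_break; case: arg_minnP => // k brk_k min_k.
apply: (iffP eqP) => [<- | [brk_i link_i]].
  split=> //; apply/forallP => j; apply/implyP => /andP[j_gt0 lt_jk].
  have: ~~ is_break S j by apply: contraL lt_jk => /min_k; rewrite leqNgt.
  rewrite /is_break j_gt0 /= negb_forall_in => /existsP[x /andP[Sx]].
  by rewrite negbK => sx; apply/existsP; exists x; rewrite Sx.
apply/eqP; rewrite -val_eqE eqn_leq min_k //= leqNgt; apply/negP => lt_ki.
have [k_gt0 /fintype.forall_inP nk] := andP brk_k.
have /implyP := forallP link_i k; rewrite k_gt0 lt_ki => /(_ isT).
by case/existsP => x /andP[/nk/negPf->].
Qed.

(** Sets S with first break i correspond to pairs of a linked set left of i and an arbitrary set
    right of i: nothing in S straddles i, so S is the disjoint union of its two windows. *)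
Lemma sum_subset_first_break (R : nzRingType) n (A : {set interval n}) (t : R) :
  (0 < n)%N -> (forall x : interval n, x \in A -> (x.1 < x.2)%N) ->
  \sum_(S : {set interval n} | S \subset A) t ^+ #|S| =
  \sum_(i < n.+1 | (0 < i)%N)
    (\sum_(S : {set interval n} |
        (S \subset window A 0 i) && linked S 0 i) t ^+ #|S|) *
    (\sum_(S : {set interval n} | S \subset window A i n) t ^+ #|S|).
Proof.
move=> n_gt0 ltA.
rewrite (partition_big (@first_break n) (fun i => 0 < i)%N) => [|S _];
  last first.
  by have /(first_breakP S _ n_gt0)[/andP[]] := eqxx (first_break S).
apply: eq_bigr => i i_gt0; rewrite big_distrl /=.
under [RHS]eq_bigr do rewrite big_distrr /=.
rewrite pair_big_dep /=.
rewrite (reindex_onto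
  (fun p : {set interval n} * {set interval n} => p.1 :|: p.2)
  (fun S : {set interval n} => (window S 0 i, window S i n)))
  => [|S /andP[/fintype.subsetP sSA]] /=; last first.
  case/(first_breakP S i n_gt0) => /andP[_ /fintype.forall_inP nS] _.
  apply/setP => x; rewrite !inE -andb_orr; case Sx: (x \in S) => //=.
  have:= nS x Sx; rewrite /straddles negb_and -!leqNgt leq_ord andbT orbC.
  by move=> ->.
have sAl (S : {set interval n}) x : S \subset window A 0 i -> x \in S ->
    [/\ x \in A, (x.1 < x.2)%N & (x.2 <= i)%N].
  move=> /fintype.subsetP sS /sS; rewrite !inE => /and3P[Ax _ ->].
  by rewrite ltA.
have sAr (S : {set interval n}) x : S \subset window A i n -> x \in S ->
    [/\ x \in A, (x.1 < x.2)%N & (i <= x.1)%N].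
  move=> /fintype.subsetP sS /sS; rewrite !inE => /and3P[Ax -> _].
  by rewrite ltA.
(* Intervals are nonempty, so none lies in both windows: that would give i <= x.1 < x.2 <= i. *)
have key (S1 S2 : {set interval n}) : S1 \subset window A 0 i ->
    S2 \subset window A i n -> [/\ window (S1 :|: S2) 0 i = S1,
    window (S1 :|: S2) i n = S2 & S1 :&: S2 = finset.set0].
  move=> s1 s2; split; apply/setP => x; rewrite !inE.
  - case S1x: (x \in S1) => /=; first by have [_ _ ->] := sAl _ _ s1 S1x.
    case S2x: (x \in S2) => //=; have [_ lt_x le_ix] := sAr _ _ s2 S2x.
    by apply/negbTE; rewrite -ltnNge (leq_ltn_trans le_ix).
  - rewrite leq_ord andbT.
    case S2x: (x \in S2).
      by have [_ _ ->] := sAr _ _ s2 S2x; rewrite orbT.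
    rewrite orbF; case S1x: (x \in S1) => //=.
    have [_ lt_x le_xi] := sAl _ _ s1 S1x.
    by apply/negbTE; rewrite -ltnNge (leq_trans lt_x).
  case S1x: (x \in S1) => //=; have [_ lt_x le_xi] := sAl _ _ s1 S1x.
  apply/negbTE/negP => /(sAr _ _ s2)[_ _ le_ix].
  by have := leq_ltn_trans le_ix (leq_trans lt_x le_xi); rewrite ltnn.
(* Intervals starting at or after i straddle no position before i. *)
have linkU (S1 S2 : {set interval n}) : S2 \subset window A i n ->
    linked (S1 :|: S2) 0 i = linked S1 0 i.
  move=> s2; apply: eq_forallb => j.
  case: ltnP => //= _; case: ltnP => //= lt_ji; apply: eq_existsb => x.
  rewrite inE; case S2x: (x \in S2); last by rewrite orbF.
  have [_ _ le_ix] := sAr _ _ s2 S2x.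
  by rewrite /straddles ltnNge ltnW ?andbF //= (leq_trans lt_ji).
apply: eq_big => [[S1 S2]|[S1 S2]] /=; last first.
  case/andP => /andP[sUA _] /eqP[e1 e2]; rewrite -exprD cardsU.
  have s1 : S1 \subset window A 0 i by rewrite -e1 windowS.
  have s2 : S2 \subset window A i n by rewrite -e2 windowS.
  by have [_ _ ->] := key S1 S2 s1 s2; rewrite cards0 subn0.
apply/andP/andP => [[/andP[sUA /(first_breakP _ _ n_gt0)[_ lk]] /eqP[e1 e2]]|].
  have s2 : S2 \subset window A i n by rewrite -e2 windowS.
  rewrite s2 -(linkU _ _ s2) lk.
  by have -> : S1 \subset window A 0 i by rewrite -e1 windowS.
case=> /andP[s1 lk] s2; have [-> -> _] := key _ _ s1 s2; split=> //.
apply/andP; split.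
  rewrite finset.subUset; apply/andP; split; apply/fintype.subsetP => x.
    by case/(sAl _ _ s1).
  by case/(sAr _ _ s2).
apply/(first_breakP _ _ n_gt0); split; last by rewrite linkU.
rewrite /is_break i_gt0; apply/fintype.forall_inP => x; rewrite inE /straddles.
rewrite negb_and -!leqNgt.
by case/orP=> [/(sAl _ _ s1)|/(sAr _ _ s2)] [_ _ ->]; rewrite ?orbT.
Qed.

(** * Standardization of words and of their factors *)

Lemma size_one_line p : size (one_line p) = plen p.
Proof. by rewrite size_map size_enum_ord. Qed.

Lemma nth_one_line n (p : 'S_n) (i : 'I_n) :
  nth 0 (one_line (existT (fun n => 'S_n) n p)) i = (p i).+1.
Proof. by rewrite (nth_map i) ?size_enum_ord //= nth_ord_enum. Qed.

Lemma one_line_inj : injective one_line.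
Proof.
case=> n p [m q] eq_pq; have := congr1 size eq_pq.
rewrite !size_one_line /= => eq_nm; case: m / eq_nm q eq_pq => q eq_pq.
congr existT; apply/permP => i; apply/val_inj.
by have /(congr1 (nth 0 ^~ i)) := eq_pq; rewrite !nth_one_line => -[].
Qed.

(** This is [std_lt] on plain natural numbers, so that words of different types of positions can be
    compared. *)
Definition precedes (w : seq nat) (i j : nat) : bool :=
  (nth 0 w i < nth 0 w j)%N || (nth 0 w i == nth 0 w j) && (i < j)%N.

Lemma one_line_std w :
  one_line (std w) = [seq (count (precedes w ^~ i) (iota 0 (size w))).+1 |
                       i <- iota 0 (size w)].
Proof.
rewrite -val_enum_ord -map_comp; apply: eq_map => i /=.
rewrite permE /= cardsE cardE count_map /enum_mem size_filter count_filter.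
by congr _.+1; apply: eq_count => j /=; rewrite andbT.
Qed.

Lemma eq_std u v : size u = size v ->
    (forall i j, (i < size u)%N -> (j < size u)%N ->
      precedes u i j = precedes v i j) ->
  std u = std v.
Proof.
move=> eq_uv prec_uv; apply: one_line_inj; rewrite !one_line_std -eq_uv.
apply/eq_in_map => i; rewrite mem_iota => /= lti; congr _.+1.
by apply/eq_in_count => j; rewrite mem_iota => /= ltj; apply: prec_uv.
Qed.

(** Ranks are injective and strictly monotone for the total order [std_lt], so the tie-break only
    ever acts on the side of [w]. *)
Lemma precedes_one_line w i j : (i < size w)%N -> (j < size w)%N ->
  precedes (one_line (std w)) i j = precedes w i j.
Proof.
move=> lti ltj; pose i' := Ordinal lti; pose j' := Ordinal ltj.
rewrite /precedes.
rewrite (nth_one_line _ i') (nth_one_line _ j') !permE ltnS eqSS.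
rewrite -[RHS]/(std_lt i' j') -[(i < j)%N]/(i' < j')%N.
have [<-|ne_ij] := eqVneq i' j'; first by rewrite std_lt_irr !ltnn andbF.
rewrite (inj_eq val_inj) (inj_eq (@std_rank_inj w)) (negPf ne_ij) /= orbF.
apply/idP/idP => [|/std_rank_mono//]; apply: contraTT => nlt.
have := std_lt_total ne_ij; rewrite (negPf nlt) /= => /std_rank_mono.
by rewrite -leqNgt => /ltnW.
Qed.

Lemma precedes_factor w m k i j : (i < m)%N -> (j < m)%N ->
  precedes (take m (drop k w)) i j = precedes w (k + i) (k + j).
Proof.
by move=> ltim ltjm; rewrite /precedes !nth_take // !nth_drop ltn_add2l.
Qed.

(** By [eq_std] a standardization depends only on the relation [precedes], which passes to factors
    and is the same for [w] and [std w]. *)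
Lemma std_factor_one_line w m k :
  std (take m (drop k (one_line (std w)))) = std (take m (drop k w)).
Proof.
apply: eq_std; first by rewrite !size_take !size_drop size_one_line.
move=> i j; rewrite size_take_min size_drop size_one_line.
rewrite !leq_min => /andP[lti lti'] /andP[ltj ltj'].
rewrite !precedes_factor // precedes_one_line //;
  by rewrite -ltn_subRL.
Qed.

Lemma std_eq_single w : (std w == perm_single) = (size w == 1%N).
Proof.
apply/eqP/eqP => [/(congr1 plen)//|]; case: w => [|n []] // _.
by congr existT; apply/permP => i; rewrite [LHS]ord1 [RHS]ord1.
Qed.

(** * Marked occurrences as intervals *)

Lemma sum_subset_imset (V : nmodType) (T T' : finType) (f : T -> T')
    (A : {set T}) (P : pred {set T'}) (F : {set T'} -> V) :
  {in A &, injective f} ->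
  \sum_(S : {set T'} | (S \subset f @: A) && P S) F S =
  \sum_(c : {set T} | (c \subset A) && P (f @: c)) F (f @: c).
Proof.
move=> f_inj.
(* The preimage is cut down to A because f is injective only there. *)
rewrite (reindex_onto (fun c : {set T} => f @: c)
  (fun S => A :&: f @^-1: S)) => [|S /andP[/fintype.subsetP sSA _]]; last first.
  apply/setP => y; apply/imsetP/idP => [[x] | Sy].
    by rewrite !inE => /andP[_ Sfx] ->.
  by have /imsetP[x Ax yE] := sSA y Sy; exists x; rewrite // !inE Ax -yE.
apply: eq_bigl => c; apply/andP/andP => [[/andP[_ Pc] /eqP cE]|[sc Pc]].
  by rewrite Pc -cE finset.subsetIl.
split; first by rewrite imsetS.
apply/eqP/setP => x; rewrite !inE.
apply/andP/idP => [[Ax /imsetP[y cy fxy]]|cx].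
  by rewrite (f_inj x y) // (fintype.subsetP sc).
by rewrite (fintype.subsetP sc) // imset_f.
Qed.

Lemma mark_pos_pat_inj n :
  injective (fun x : marks n => (mark_pos x, mark_pat x)).
Proof.
case=> p [m s] [q [m' s']] /pair_equal_spec[/val_inj /= <- pat_eq].
have e : m = m' by apply/val_inj; exact: (congr1 plen pat_eq).
case: m' / e s' pat_eq => s' /eqP.
by rewrite /mark_pat /= -tag_eqE /tag_eq eqxx tagged_asE /= => /eqP->.
Qed.

Lemma ex_mark n p (sigma : perms) : (p <= n)%N -> (plen sigma <= n)%N ->
  exists x : marks n, mark_pos x = p /\ mark_pat x = sigma.
Proof.
case: sigma => m sg; rewrite -ltnS -[in X in _ -> X -> _]ltnS => lt_p lt_m.
by exists (Ordinal lt_p, existT (fun m : 'I_n.+1 => 'S_m) (Ordinal lt_m) sg).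
Qed.

Definition factor (w : seq nat) (a b : nat) : seq nat :=
  take (b - a) (drop a w).

Lemma size_factor w a b : (b <= size w)%N -> size (factor w a b) = (b - a)%N.
Proof. by move=> le_b; rewrite size_takel // size_drop leq_sub2r. Qed.

Lemma take_drop_factor w a b p m : (p + m <= b - a)%N ->
  take m (drop p (factor w a b)) = factor w (a + p) (a + p + m).
Proof.
move=> le_pm; rewrite /factor addKn [LHS]take_drop take_takel;
  last by rewrite addnC.
by rewrite -take_drop drop_drop [(p + a)%N]addnC.
Qed.

(** The interval alone records a marked occurrence, its pattern being the standardization of the
    factor. Pairs with x.2 <= x.1 give the empty factor, which is excluded once patterns have length
    at least 2. *)
Definition factor_occs (Gamma : set perms) (w : seq nat) :
    {set interval (size w)} :=
  [set x : interval (size w) | std (factor w x.1 x.2) \in Gamma].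

(** The offset a moves positions in a factor to positions in the whole word. [inord] yields the
    intended endpoints only when they are at most N, as they are for marked occurrences by
    [marked_occurrence_spec]. *)
Definition mark_interval N a n (x : marks n) : interval N :=
  (inord (a + mark_pos x), inord (a + mark_pos x + plen (mark_pat x))).

Lemma factor_occs_lt (Gamma : set perms) w
    (Gamma_len : forall sigma : perms, Gamma sigma -> (2 <= plen sigma)%N)
    (x : interval (size w)) :
  x \in factor_occs Gamma w -> (x.1.+2 <= x.2)%N.
Proof.
rewrite finset.in_set => /set_mem/Gamma_len.
by rewrite /plen /= size_factor ?leq_ord //; lia.
Qed.

Lemma marked_occurrence_spec (Gamma : set perms) w a b
    (x : marks (plen (std (factor w a b)))) :
    (a <= b)%N -> (b <= size w)%N ->
  x \in marked_occurrences Gamma (std (factor w a b)) ->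
  [/\ (a + mark_pos x + plen (mark_pat x) <= b)%N,
     Gamma (mark_pat x),
     std (factor w (a + mark_pos x) (a + mark_pos x + plen (mark_pat x)))
       = mark_pat x,
     (mark_interval (size w) a x).1 = (a + mark_pos x)%N :> nat &
     (mark_interval (size w) a x).2 =
       (a + mark_pos x + plen (mark_pat x))%N :> nat].
Proof.
move=> le_ab le_bw; rewrite /marked_occurrences finset.in_set /occurs_at.
case/andP=> /set_mem Gx /andP[].
rewrite -[X in (_ <= X)%N]/(size (factor w a b)) size_factor // => le_x.
rewrite std_factor_one_line take_drop_factor // => /eqP std_x.
have le_xb : (a + mark_pos x + plen (mark_pat x) <= b)%N by lia.
split=> //; apply: inordK; lia.
Qed.

Lemma mark_interval_inj (Gamma : set perms) w a b :
    (a <= b)%N -> (b <= size w)%N ->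
  {in marked_occurrences Gamma (std (factor w a b)) &,
    injective (@mark_interval (size w) a (plen (std (factor w a b))))}.
Proof.
move=> le_ab le_bw x y /(marked_occurrence_spec le_ab le_bw)[_ _ std_x x1 x2].
case/(marked_occurrence_spec le_ab le_bw)=> _ _ std_y y1 y2 eq_xy.
have eq1 : mark_pos x = mark_pos y by apply: (@addnI a); rewrite -x1 -y1 eq_xy.
apply: mark_pos_pat_inj; congr pair => //.
by rewrite -std_x -std_y -x2 -x1 -y2 -y1 eq_xy.
Qed.

Lemma imset_mark_interval (Gamma : set perms) w a b
    (Gamma_len : forall sigma : perms, Gamma sigma -> (2 <= plen sigma)%N) :
    (a <= b)%N -> (b <= size w)%N ->
  [set mark_interval (size w) a x |
    x in marked_occurrences Gamma (std (factor w a b))] =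
  window (factor_occs Gamma w) a b.
Proof.
move=> le_ab le_bw; apply/setP => y; apply/imsetP/idP => [[x MOx ->]|].
  have [le_x Gx std_x x1 x2] := marked_occurrence_spec le_ab le_bw MOx.
  by rewrite !finset.in_set x1 x2 std_x le_x leq_addr mem_set.
rewrite finset.in_set => /andP[Gy /andP[le_ay le_yb]].
have lt_y := factor_occs_lt Gamma_len Gy.
have size_y : plen (std (factor w y.1 y.2)) = (y.2 - y.1)%N.
  by rewrite /plen /= size_factor ?leq_ord.
have size_ab : plen (std (factor w a b)) = (b - a)%N.
  by rewrite /plen /= size_factor.
have [||x [x_pos x_pat]] :=
  @ex_mark (plen (std (factor w a b))) (y.1 - a) (std (factor w y.1 y.2)).
- by rewrite size_ab; lia.
- by rewrite size_ab size_y; lia.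
have e1 : (a + (y.1 - a) = y.1)%N by lia.
have e2 : (y.1 + (y.2 - y.1) = y.2)%N by lia.
exists x; last first.
  by rewrite /mark_interval x_pos x_pat size_y e1 e2 !inord_val; case: (y).
move: Gy; rewrite /marked_occurrences !finset.in_set /occurs_at x_pos x_pat.
move=> ->; rewrite andTb size_y std_factor_one_line take_drop_factor ?e1 ?e2 ?eqxx ?andbT;
  last lia.
by rewrite size_ab; lia.
Qed.

(** The cluster condition at j concerns the gap between letters j and j + 1 of the factor, which is
    position a + j + 1 of [w]: hence the shift by one. *)
Lemma linked_mark_interval (Gamma : set perms) w a b
    (c : {set marks (plen (std (factor w a b)))}) :
    (a <= b)%N -> (b <= size w)%N ->
    c \subset marked_occurrences Gamma (std (factor w a b)) ->
  linked [set mark_interval (size w) a x | x in c] a b =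
  [forall j : 'I_(plen (std (factor w a b))).-1, exists x in c,
    (mark_pos x <= j)%N && (j.+1 < mark_pos x + plen (mark_pat x))%N].
Proof.
move=> le_ab le_bw /fintype.subsetP sc.
have size_ab : plen (std (factor w a b)) = (b - a)%N.
  by rewrite /plen /= size_factor.
apply/forallP/forallP => [lk j | lk j].
  have lt_j := ltn_ord j; rewrite [X in (_ < X.-1)%N]size_ab in lt_j.
  have lt_jw : (a + j.+1 < (size w).+1)%N by lia.
  have in_ab : (a < a + j.+1 < b)%N by lia.
  have /implyP/(_ in_ab)/existsP[y] := lk (Ordinal lt_jw).
  case/andP=> /imsetP[x cx ->]; rewrite /straddles.
  have [_ _ _ -> ->] := marked_occurrence_spec le_ab le_bw (sc x cx).
  move=> str; apply/existsP; exists x; rewrite cx andTb.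
  by move: str; rewrite -[nat_of_ord (Ordinal _)]/(a + j.+1)%N; lia.
apply/implyP => /andP[lt_aj lt_jb].
have lt_j : (j - a.+1 < (plen (std (factor w a b))).-1)%N.
  by rewrite [X in (_ < X.-1)%N]size_ab; lia.
have /existsP[x /andP[cx]] := lk (Ordinal lt_j).
rewrite -[nat_of_ord (Ordinal _)]/(j - a.+1)%N => str.
apply/existsP; exists (mark_interval (size w) a x); rewrite imset_f // andTb.
rewrite /straddles.
by have [_ _ _ -> ->] := marked_occurrence_spec le_ab le_bw (sc x cx); lia.
Qed.

Lemma sum_expr_window (R : comNzRingType) (t : R) (Gamma : set perms)
    (Gamma_len : forall sigma : perms, Gamma sigma -> (2 <= plen sigma)%N)
    w a b : (a <= b)%N -> (b <= size w)%N ->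
  \sum_(S : {set interval (size w)} |
      S \subset window (factor_occs Gamma w) a b) t ^+ #|S| =
  (1 + t) ^+ occ Gamma (std (factor w a b)).
Proof.
move=> le_ab le_bw; rewrite sum_expr_subset -imset_mark_interval //.
by rewrite card_in_imset //; apply: mark_interval_inj.
Qed.

(** Linked sets are clusters except that clusters must be nonempty. For length at least 2 linkedness
    forces this; for length 1 there are no marks, and the empty set, vacuously linked, accounts for
    the term of G_1. *)
Lemma sum_expr_linked (R : comNzRingType) (t : R) (Gamma : set perms)
    (Gamma_len : forall sigma : perms, Gamma sigma -> (2 <= plen sigma)%N)
    w a b : (a < b)%N -> (b <= size w)%N ->
  \sum_(S : {set interval (size w)} |
      (S \subset window (factor_occs Gamma w) a b) && linked S a b) t ^+ #|S| =
  (std (factor w a b) == perm_single)%:R +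
  \sum_(c in clusters Gamma (std (factor w a b))) t ^+ mk c.
Proof.
move=> lt_ab le_bw; have le_ab := ltnW lt_ab.
rewrite -imset_mark_interval // sum_subset_imset; last exact: mark_interval_inj.
set MO := marked_occurrences _ _.
transitivity (\sum_(c : {set marks (plen (std (factor w a b)))} |
    (c \subset MO) &&
    [forall j : 'I_(plen (std (factor w a b))).-1, exists x in c,
      (mark_pos x <= j)%N && (j.+1 < mark_pos x + plen (mark_pat x))%N])
    t ^+ mk c).
  apply: eq_big => [c|c /andP[sc _]].
    by case sc: (c \subset MO); rewrite //= (linked_mark_interval _ _ sc).
  rewrite card_in_imset // => x y /(fintype.subsetP sc) MOx.
  by move/(fintype.subsetP sc); move: MOx; apply: mark_interval_inj.
have size_ab : size (factor w a b) = (b - a)%N by rewrite size_factor.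
rewrite std_eq_single size_ab; case: eqVneq => [ba1|ba1]; last first.
  rewrite add0r; apply: eq_bigl => c; rewrite inE /is_cluster -/MO.
  case: (c \subset MO); rewrite ?andbF //=; apply/idP/andP => [cov|[]//].
  (* The first gap exists, and any mark covering it shows that c is nonempty. *)
  split=> //; have lt0 : (0 < (plen (std (factor w a b))).-1)%N.
    by rewrite [X in (_ < X.-1)%N]size_ab; lia.
  have /existsP[x /andP[cx _]] := forallP cov (Ordinal lt0).
  by apply/finset.set0Pn; exists x.
have MO0 : MO = finset.set0.
  apply/setP => x; rewrite [RHS]inE; apply/negP.
  case/(marked_occurrence_spec le_ab le_bw) => le_x /Gamma_len; lia.
rewrite (big_pred1 finset.set0) => [|c]; last first.
  rewrite MO0 finset.subset0 -[RHS]/(c == finset.set0).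
  case: (c == _) => //; apply/forallP => -[j lt_j].
  by exfalso; move: lt_j; rewrite [X in (_ < X.-1)%N]size_ab ba1.
rewrite /mk cards0 expr0 big_pred0 ?addr0 // => c.
rewrite inE /is_cluster -/MO MO0 finset.subset0.
by case: (c == _).
Qed.

(** * The inverse of 1 - G_1 - R(s - 1) *)

Lemma factor_prefix w b : factor w 0 b = take b w.
Proof. by rewrite /factor subn0 drop0. Qed.

Lemma factor_suffix w a : factor w a (size w) = drop a w.
Proof. by rewrite /factor -size_drop take_size. Qed.

Lemma window_full n (A : {set interval n}) : window A 0 n = A.
Proof. by apply/setP => x; rewrite finset.in_set leq_ord !andbT. Qed.

Lemma marked_occurrences_nil (Gamma : set perms)
    (Gamma_len : forall sigma : perms, Gamma sigma -> (2 <= plen sigma)%N) :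
  marked_occurrences Gamma (std [::]) = finset.set0.
Proof.
apply/setP => x; rewrite [RHS]finset.in_set; apply/negP => MOx.
have [le_x /Gamma_len] :=
  @marked_occurrence_spec Gamma [::] 0 0 x (leqnn 0) (leqnn 0) MOx.
lia.
Qed.

Theorem theorem3p1 (Gamma : set perms)
    (Gamma_len : forall sigma : perms, Gamma sigma -> (2 <= plen sigma)%N) :
  let s : QAs := ps_var (ncseries rat) in
  let D : QAs := 1 - ps_const (G perm_single) - Rbar Gamma (s - 1) in
  D \is a GRing.unit /\ Fbar Gamma s = D^-1.
Proof.
move=> s D; pose t : {poly rat} := 'X - 1.
(* [E] and [K] are F(s) and G_1 + R(s - 1) before the embedding [of_pncs]. *)
pose E : ncseries {poly rat} := fun w => 'X ^+ occ Gamma (std w).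
pose K : ncseries {poly rat} := fun w =>
  (std w == perm_single)%:R + \sum_(c in clusters Gamma (std w)) t ^+ mk c.
have FE : Fbar Gamma s = of_pncs E.
  rewrite -(formal_sum_G (fun pi => 'X ^+ occ Gamma pi)) /Fbar.
  congr formal_sum; apply/funext => pi.
  by rewrite !rmorphXn /= of_pncsX.
have RE : Rbar Gamma (s - 1) =
    of_pncs (fun w => \sum_(c in clusters Gamma (std w)) t ^+ mk c).
  rewrite -(formal_sum_G (fun pi => \sum_(c in clusters Gamma pi) t ^+ mk c)).
  congr formal_sum; apply/funext => pi; rewrite !rmorph_sum; congr (_ * _).
  apply: eq_bigr => c _; rewrite !rmorphXn; congr (_ ^+ _).
  by rewrite !rmorphB !rmorph1 /= of_pncsX.
have DE : D = of_pncs (1 - K).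
  rewrite /D RE -of_pncsC -addrA -opprD -(rmorph1 of_pncs) -rmorphD -rmorphB.
  congr (of_pncs (1 - _)); apply/funext => w.
  by rewrite /K -[LHS]/(_ + _) /G; case: (_ == _).
have K0 : K [::] = 0.
  rewrite /K std_eq_single add0r big_pred0 // => c; apply/negP.
  rewrite finset.in_set /is_cluster marked_occurrences_nil // finset.subset0.
  by case: (c == _).
have KE : (1 - K) * E = 1.
  apply/funext => w; rewrite mulrBl mul1r ncs_subE ncs_oneE ncs_mulE.
  have tE : 1 + t = 'X by rewrite addrC subrK.
  case: (posnP (size w)) => [/size0nil->|w_gt0].
    rewrite big_ord1 take0 K0 mul0r subr0 /E.
    by rewrite /occ marked_occurrences_nil // cards0 expr0.
  have -> : (w == [::]) = false by case: (w) w_gt0.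
  apply/eqP; rewrite subr_eq0 /E; apply/eqP.
  transitivity ((1 + t) ^+ occ Gamma (std (factor w 0 (size w)))).
    by rewrite factor_prefix take_size tE.
  rewrite -sum_expr_window // window_full sum_subset_first_break //; last first.
    by move=> x /(factor_occs_lt Gamma_len)/ltnW.
  (* A first break is positive, while the product K E also has the term i = 0; that term vanishes
     because [K] has no constant term. *)
  rewrite [RHS](bigID (fun i : 'I_(size w).+1 => 0 < i)%N) /=.
  rewrite [X in _ = _ + X]big1 ?addr0.
    apply: eq_bigr => i i_gt0; rewrite sum_expr_linked ?leq_ord //.
    by rewrite sum_expr_window ?leq_ord // factor_prefix factor_suffix tE.
  by move=> i; rewrite lt0n negbK => /eqP ->; rewrite take0 K0 mul0r.
have EK := ncs_right_inverse_left K0 KE.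
have uD : D \is a GRing.unit.
  by apply/unitrP; exists (of_pncs E); rewrite DE -!rmorphM KE EK rmorph1.
by split=> //; apply: (mulrI uD); rewrite divrr // FE DE -rmorphM KE rmorph1.
Qed.
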